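(* Let $S$ be a finite semigroup. The relation $\eta^{*}$ is the smallest congruence relation on $S$ such that $S/\eta^{*}$ is a nilpotent semigroup; that is, $S/\eta^{*}$ is nilpotent, and $\eta^{*}\subseteq\rho$ for every congruence $\rho$ on $S$ such that $S/\rho$ is nilpotent.
   Context: For a semigroup $S$, $S^1$ denotes $S$ if $S$ has an identity, and $S$ with an identity $1$ adjoined otherwise. For $x,y,z_1,z_2,\ldots$ in $S^1$ define recursively $\lambda_0=x$, $\rho_0=y$, and $\lambda_{n+1}=\lambda_n z_{n+1}\rho_n$, $\rho_{n+1}=\rho_n z_{n+1}\lambda_n$, where $\lambda_n=\lambda_n(x,y,z_1,\ldots,z_n)$ and $\rho_n=\rho_n(x,y,z_1,\ldots,z_n)$. A semigroup $S$ is nilpotent (in the sense of Mal'cev) if there is a positive integer $n$ such that $\lambda_n(a,b,c_1,\ldots,c_n)=\rho_n(a,b,c_1,\ldots,c_n)$ for all $a,b\in S$ and $c_1,\ldots,c_n\in S^1$. For a semigroup $S$ let $\eta_1=\{(x,x)\mid x\in S\}$ and, for every integer $n>1$, let $x\,\eta_n\,y$ if and only if there exist $z_1,\ldots,z_n\in S^1$ such that $x=\lambda_n(x,y,z_1,\ldots,z_n)$ and $y=\rho_n(x,y,z_1,\ldots,z_n)$. Let $\eta$ be the transitive closure of $\bigcup_{i\ge 1}\eta_i$, and let $\eta^{*}$ be the smallest congruence on $S$ containing $\eta$. *)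

(* Defs.v *)
From HB Require Import structures.
From Stdlib Require Import Relation_Operators.
From mathcomp Require Import all_boot.
From mathcomp Require Import generic_quotient boolp.

Set Implicit Arguments.
Unset Strict Implicit.
Unset Printing Implicit Defensive.

Local Open Scope group_scope.
Local Open Scope quotient_scope.

#[short(type="finSemigroupType")]
HB.structure Definition FinSemigroup := {S of Semigroup S & Finite S}.

Definition has_identity (S : semigroupType) : Prop :=
  exists e : S, (forall x : S, e * x = x) /\ (forall x : S, x * e = x).

(* S^1: the constructor [AdjOne] is available only when S has no identity,
   so that S^1 is a copy of S otherwise. *)
Inductive with_one (S : semigroupType) : Type :=
  | OfS of S
  | AdjOne of ~ has_identity S.
Arguments OfS {S}.
Arguments AdjOne {S}.

HB.instance Definition _ (S : semigroupType) := gen_eqMixin (with_one S).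
HB.instance Definition _ (S : semigroupType) := gen_choiceMixin (with_one S).

Definition with_one_mul (S : semigroupType) (x y : with_one S) : with_one S :=
  match x, y with
  | OfS a, OfS b => OfS (a * b)
  | OfS a, AdjOne _ => OfS a
  | AdjOne _, _ => y
  end.

Lemma with_one_mulA (S : semigroupType) : associative (@with_one_mul S).
Proof. by case=> [a|h] [b|h'] [c|h''] //=; rewrite mulgA. Qed.

HB.instance Definition _ (S : semigroupType) :=
  isSemigroup.Build (with_one S) (@with_one_mulA S).

Lemma with_one_has_identity (S : semigroupType) : has_identity (with_one S).
Proof.
have [[e [le re]]|h] := pselect (has_identity S).
  exists (OfS e); split=> -[a|h]; try by case: h; exists e.
    by congr OfS; apply: le.
  by congr OfS; apply: re.
exists (AdjOne h); split=> -[a|h'] //.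
by congr AdjOne; apply: Prop_irrelevance.
Qed.

Section Malcev.
Variable M : semigroupType.

(* The pair (lambda_n, rho_n), where zs lists z_1, ..., z_n in this order. *)
Definition lambda_rho (x y : M) (zs : seq M) : M * M :=
  foldl (fun p z => (p.1 * z * p.2, p.2 * z * p.1)) (x, y) zs.

Definition lambda (x y : M) (zs : seq M) : M := (lambda_rho x y zs).1.
Definition rho (x y : M) (zs : seq M) : M := (lambda_rho x y zs).2.

Lemma lambda_rcons x y zs z :
  lambda x y (rcons zs z) = lambda x y zs * z * rho x y zs.
Proof. by rewrite /lambda /lambda_rho foldl_rcons. Qed.

Lemma rho_rcons x y zs z :
  rho x y (rcons zs z) = rho x y zs * z * lambda x y zs.
Proof. by rewrite /rho /lambda_rho foldl_rcons. Qed.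

End Malcev.

Definition malcev_nilpotent (S : semigroupType) : Prop :=
  exists2 n : nat, (0 < n)%N &
    forall (a b : S) (c : n.-tuple (with_one S)),
      lambda (OfS a) (OfS b) c = rho (OfS a) (OfS b) c.

Record congruence (S : semigroupType) := Congruence {
  cong_rel :> rel S;
  cong_equiv : equivalence_rel cong_rel;
  cong_mul : forall a b c d : S,
    cong_rel a b -> cong_rel c d -> cong_rel (a * c) (b * d)
}.

Section Quotient.
Variables (S : semigroupType) (R : congruence S).

Lemma cong_refl : reflexive R.
Proof. by move=> x; have [] := cong_equiv R x x x. Qed.

Lemma cong_sym : symmetric R.
Proof.
have [r t] := (equivalence_relP R).1 (cong_equiv R).
by move=> x y; apply/idP/idP=> h; rewrite -(t _ _ h) r.
Qed.

Lemma cong_trans : transitive R.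
Proof.
have [_ t] := (equivalence_relP R).1 (cong_equiv R).
by move=> y x z /t ->.
Qed.

Canonical cong_equiv_rel := EquivRel R cong_refl cong_sym cong_trans.

Definition quotient_sg : Type := {eq_quot cong_equiv_rel}.
HB.instance Definition _ := Choice.on quotient_sg.
HB.instance Definition _ := EqQuotient.on quotient_sg.

Definition quotient_mul (u v : quotient_sg) : quotient_sg :=
  \pi_quotient_sg (repr u * repr v).

Lemma pi_quotient_mul (x y : S) :
  \pi_quotient_sg (x * y) = quotient_mul (\pi x) (\pi y).
Proof.
by apply/eqmodP; apply: (@cong_mul S R); rewrite cong_sym; apply/eqmodP; rewrite reprK.
Qed.

Lemma quotient_mulA : associative quotient_mul.
Proof.
move=> u v w; rewrite -[u]reprK -[v]reprK -[w]reprK.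
by rewrite -!pi_quotient_mul mulgA.
Qed.

HB.instance Definition _ := isSemigroup.Build quotient_sg quotient_mulA.

Lemma pi_quotientM : {morph \pi_quotient_sg : x y / x * y}.
Proof. exact: pi_quotient_mul. Qed.

Lemma pi_quotientP (x y : S) :
  reflect (\pi_quotient_sg x = \pi_quotient_sg y) (R x y).
Proof. exact/(iffP (eqmodP _ _ _)). Qed.

End Quotient.

Section Eta.
Variable S : semigroupType.

Definition eta_n (n : nat) (x y : S) : Prop :=
  if (1 < n)%N then
    exists z : n.-tuple (with_one S),
      OfS x = lambda (OfS x) (OfS y) z /\ OfS y = rho (OfS x) (OfS y) z
  else x = y.

Definition eta : S -> S -> Prop :=
  clos_trans S (fun x y => exists2 i : nat, (1 <= i)%N & eta_n i x y).

Definition eta_star_rel : rel S := fun x y =>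
  `[< forall R : congruence S, (forall a b, eta a b -> R a b) -> R x y >].

Lemma eta_star_equiv : equivalence_rel eta_star_rel.
Proof.
apply/equivalence_relP; split=> [x|x y /asboolP xy z].
  by apply/asboolP=> R _; apply: cong_refl.
apply/asboolP/asboolP => h R RE; last exact: cong_trans (xy R RE) (h R RE).
by apply: cong_trans (h R RE); rewrite cong_sym; apply: xy.
Qed.

Lemma eta_star_mul (a b c d : S) :
  eta_star_rel a b -> eta_star_rel c d -> eta_star_rel (a * c) (b * d).
Proof.
move=> /asboolP ab /asboolP cd; apply/asboolP=> R RE.
exact: cong_mul (ab R RE) (cd R RE).
Qed.

Definition eta_star : congruence S := Congruence eta_star_equiv eta_star_mul.

Lemma eta_sub_eta_star (x y : S) : eta x y -> eta_star x y.
Proof. by move=> xy; apply/asboolP=> R; apply. Qed.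

Lemma eta_star_min (R : congruence S) :
  (forall x y, eta x y -> R x y) -> forall x y, eta_star x y -> R x y.
Proof. by move=> RE x y /asboolP; apply. Qed.

End Eta.

(* Main.v *)
(** A pair (x, y) that recurs along the recursion defining lambda and rho,
    driven by z_1, ..., z_m, recurs along every repetition of z_1, ..., z_m,
    hence at arbitrarily late stages, where the two components agree in any
    nilpotent quotient; so eta is contained in every congruence with nilpotent
    quotient. Conversely, along any |S|^2 steps starting in S some pair
    (lambda_i, rho_i) recurs, so lambda_i eta rho_i, and from then on the two
    components agree modulo eta*. *)
Require Import Defs.
From Stdlib Require Import Relation_Operators.
From mathcomp Require Import all_boot.
From mathcomp Require Import generic_quotient boolp.

Set Implicit Arguments.
Unset Strict Implicit.
Unset Printing Implicit Defensive.

Local Open Scope group_scope.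
Local Open Scope quotient_scope.

Section Sandwich.
Variable S : semigroupType.
Implicit Types (a b x y : S) (z : with_one S) (zs : seq (with_one S)).

(* The product a z b, which lies in S although z ranges over S^1. *)
Definition sandwich a z b : S :=
  match z with OfS c => a * c * b | AdjOne _ => a * b end.

Lemma OfS_sandwich a z b : OfS (sandwich a z b) = OfS a * z * OfS b.
Proof. by case: z. Qed.

(** Running the recursion in [S] rather than [S^1] lets it be counted by [#|{: S * S}|] and
    projected to a quotient of [S]. *)
Definition sandwich_pair (x y : S) zs : S * S :=
  foldl (fun p z => (sandwich p.1 z p.2, sandwich p.2 z p.1)) (x, y) zs.

Lemma lambda_rho_OfS x y zs :
  lambda_rho (OfS x) (OfS y) zs =
  (OfS (sandwich_pair x y zs).1, OfS (sandwich_pair x y zs).2).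
Proof.
by elim: zs x y => //= z zs IH x y; rewrite /lambda_rho /= -!OfS_sandwich; apply: IH.
Qed.

Lemma lambda_OfS x y zs :
  lambda (OfS x) (OfS y) zs = OfS (sandwich_pair x y zs).1.
Proof. by rewrite /lambda lambda_rho_OfS. Qed.

Lemma rho_OfS x y zs : rho (OfS x) (OfS y) zs = OfS (sandwich_pair x y zs).2.
Proof. by rewrite /rho lambda_rho_OfS. Qed.

Lemma sandwich_pair_cat x y zs1 zs2 :
  sandwich_pair x y (zs1 ++ zs2) =
  sandwich_pair (sandwich_pair x y zs1).1 (sandwich_pair x y zs1).2 zs2.
Proof. by rewrite /sandwich_pair foldl_cat -surjective_pairing. Qed.

Lemma sandwich_pair_diag x zs :
  (sandwich_pair x x zs).1 = (sandwich_pair x x zs).2.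
Proof. by elim: zs x => //= z zs IH x; apply: IH. Qed.

Lemma sandwich_pair_eq_cat x y zs1 zs2 :
  (sandwich_pair x y zs1).1 = (sandwich_pair x y zs1).2 ->
  (sandwich_pair x y (zs1 ++ zs2)).1 = (sandwich_pair x y (zs1 ++ zs2)).2.
Proof. by rewrite sandwich_pair_cat => ->; apply: sandwich_pair_diag. Qed.

Lemma sandwich_pair_repeat x y zs n :
  sandwich_pair x y zs = (x, y) ->
  sandwich_pair x y (flatten (nseq n zs)) = (x, y).
Proof. by move=> h; elim: n => //= n IH; rewrite sandwich_pair_cat h. Qed.

Lemma eta_n_sandwich_pair n x y : eta_n n x y ->
  x = y \/ exists2 zs, (0 < size zs)%N & sandwich_pair x y zs = (x, y).
Proof.
rewrite /eta_n; case: ifP => [n1 [zs [hx hy]]|_ ->]; last by left.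
right; exists zs; first by rewrite size_tuple ltnW.
move: hx hy; rewrite lambda_OfS rho_OfS => -[hx] [hy].
by rewrite [LHS]surjective_pairing -hx -hy.
Qed.

(* The definition of eta_n asks for at least two factors; repeating zs once
   covers the case of a single one. *)
Lemma sandwich_pair_eta x y zs :
  (0 < size zs)%N -> sandwich_pair x y zs = (x, y) -> eta x y.
Proof.
move=> zs0 h; have := sandwich_pair_repeat 2 h; set ws := flatten _ => hw.
have ws1 : (1 < size ws)%N.
  by rewrite /ws /= cats0 size_cat addnn -[2%N]/(1.*2)%N leq_double.
apply: t_step; exists (size ws); first exact: ltnW.
by rewrite /eta_n ws1; exists (in_tuple ws); rewrite lambda_OfS rho_OfS hw.
Qed.

(** Once the two components agree they agree at all later stages, so a fixed length [n] may be
    replaced by all lengths from [n] on. *)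
Lemma malcev_nilpotentP :
  malcev_nilpotent S <->
  exists2 n : nat, (0 < n)%N & forall x y (zs : seq (with_one S)),
    (n <= size zs)%N -> (sandwich_pair x y zs).1 = (sandwich_pair x y zs).2.
Proof.
split=> -[n n0 nilS]; exists n => //.
  move=> x y zs nzs.
  have sz : size (take n zs) == n by rewrite size_take_min; apply/eqP/minn_idPl.
  have := nilS x y (Tuple sz); rewrite lambda_OfS rho_OfS /= => -[h].
  by rewrite -(cat_take_drop n zs); apply: sandwich_pair_eq_cat.
by move=> x y zs; rewrite lambda_OfS rho_OfS nilS ?size_tuple.
Qed.

End Sandwich.

(** Pigeonhole: counting the empty one, [zs] has [(size zs).+1] prefixes, more than there are
    pairs. *)
Lemma sandwich_pair_recurs (S : finSemigroupType) (x y : S)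
    (zs : seq (with_one S)) :
  (#|{: S * S}| <= size zs)%N ->
  exists i j, [/\ (i < j)%N, (j <= size zs)%N &
    sandwich_pair x y (take i zs) = sandwich_pair x y (take j zs)].
Proof.
move=> szs; pose f (i : 'I_(size zs).+1) := sandwich_pair x y (take i zs).
have /injectivePn [i [j ij fij]] : ~~ injectiveb f.
  by apply/injectiveP => /leq_card; rewrite card_ord leqNgt ltnS szs.
wlog lt_ij : i j ij fij / (i < j)%N.
  move=> H; have [/H|/H|/val_inj e] := ltngtP i j; first exact.
    by apply; rewrite 1?eq_sym.
  by rewrite e eqxx in ij.
by exists i, j; split=> //; rewrite -ltnS.
Qed.

Section QuotientSandwich.
Variables (S : semigroupType) (R : congruence S).
Let Q : semigroupType := quotient_sg R.
Local Notation pi := (\pi_(quotient_sg R)).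

Lemma quotient_has_identity : has_identity S -> has_identity Q.
Proof.
move=> [e [le re]]; exists (pi e : Q).
by split=> u; rewrite -[u]reprK -pi_quotientM ?le ?re.
Qed.

(* Q may have an identity while S has none, in which case the adjoined
   identity of S^1 is sent to the identity of Q. *)
Definition with_one_pi (z : with_one S) : with_one Q :=
  match z with
  | OfS a => OfS (pi a)
  | AdjOne _ => projT1 (cid (with_one_has_identity Q))
  end.

(** An identity of [S] would project to one of [Q], so the adjoined identity lifts to an adjoined
    identity. *)
Definition with_one_repr (u : with_one Q) : with_one S :=
  match u with
  | OfS a => OfS (repr a)
  | AdjOne h => AdjOne (fun hS => h (quotient_has_identity hS))
  end.

Lemma sandwich_pi a z b :
  sandwich (pi a : Q) (with_one_pi z) (pi b) = pi (sandwich a z b).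
Proof.
case: z => [c|h]; first by rewrite /= !pi_quotientM.
(* In [Q^1] the middle factor is an identity and cancels; injectivity of [OfS] brings the equation
   back to [Q]. *)
suff [] : OfS (sandwich (pi a : Q) (with_one_pi (AdjOne h)) (pi b)) =
          OfS (pi (a * b) : Q) by [].
rewrite OfS_sandwich /with_one_pi; case: cid => e [_ /= ->].
by rewrite pi_quotientM.
Qed.

Lemma sandwich_repr a u b :
  sandwich (pi a : Q) u (pi b) = pi (sandwich a (with_one_repr u) b).
Proof. by case: u => [c|h] /=; rewrite !pi_quotientM ?reprK. Qed.

Lemma sandwich_pair_pi x y zs :
  sandwich_pair (pi x : Q) (pi y) (map with_one_pi zs) =
  (pi (sandwich_pair x y zs).1, pi (sandwich_pair x y zs).2).
Proof.
elim: zs x y => //= z zs IH x y.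
by rewrite /sandwich_pair /= !sandwich_pi; apply: IH.
Qed.

Lemma sandwich_pair_repr x y us :
  sandwich_pair (pi x : Q) (pi y) us =
  (pi (sandwich_pair x y (map with_one_repr us)).1,
   pi (sandwich_pair x y (map with_one_repr us)).2).
Proof.
elim: us x y => //= u us IH x y.
by rewrite /sandwich_pair /= !sandwich_repr; apply: IH.
Qed.

Lemma eta_sub_nilpotent_congruence x y :
  malcev_nilpotent Q -> eta x y -> R x y.
Proof.
move=> /malcev_nilpotentP [n _ nilQ].
elim=> {x y} [x y [i _]|x y z _ xy _ yz]; last exact: cong_trans xy yz.
move=> /eta_n_sandwich_pair [->|[zs zs0 h]]; first exact: cong_refl.
(* As [zs] is nonempty, [n] copies of it reach length [n]. *)
apply/pi_quotientP; pose ws := flatten (nseq n zs).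
have := nilQ (pi x) (pi y) (map with_one_pi ws).
rewrite sandwich_pair_pi sandwich_pair_repeat //; apply.
by rewrite size_map size_flatten /shape map_nseq sumn_nseq leq_pmull.
Qed.

End QuotientSandwich.

Lemma quotient_nilpotent (S : finSemigroupType) (R : congruence S) :
  (forall x y, eta x y -> R x y) -> malcev_nilpotent (quotient_sg R).
Proof.
(* The recurrence takes [#|{: S * S}|] steps; the successor makes the bound visibly positive. *)
move=> etaR; apply/malcev_nilpotentP; exists #|{: S * S}|.+1 => // u v us sus.
rewrite -[u]reprK -[v]reprK; set x := repr u; set y := repr v.
rewrite sandwich_pair_repr /=; set zs := map _ us.
have szs : (#|{: S * S}| <= size zs)%N by rewrite size_map ltnW.
have [i [j [ij jzs e]]] := sandwich_pair_recurs x y szs.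
(* The segment between stages [i] and [j] returns the pair of stage [i] to itself. *)
have Dj : take j zs = take i zs ++ drop i (take j zs).
  by rewrite -{1}(cat_take_drop i (take j zs)) -take_min (minn_idPl (ltnW ij)).
have /etaR/pi_quotientP pi_eq :
    eta (sandwich_pair x y (take i zs)).1 (sandwich_pair x y (take i zs)).2.
  apply: (@sandwich_pair_eta _ _ _ (drop i (take j zs))).
    by rewrite size_drop size_takel // subn_gt0.
  by rewrite -sandwich_pair_cat -Dj -e -surjective_pairing.
(* The remaining factors are projected to [Q^1], where the recursion now starts from two equal
   classes. *)
rewrite -(cat_take_drop i zs) sandwich_pair_cat.
have := sandwich_pair_pi R (sandwich_pair x y (take i zs)).1
  (sandwich_pair x y (take i zs)).2 (drop i zs).
rewrite pi_eq; set p := sandwich_pair _ _ _ => Dp.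
have := sandwich_pair_diag (\pi_(quotient_sg R) (sandwich_pair x y (take i zs)).2
  : quotient_sg R) (map (with_one_pi R) (drop i zs)).
by rewrite -/p Dp.
Qed.

Theorem lemma2p2 (S : finSemigroupType) :
  malcev_nilpotent (quotient_sg (eta_star S)) /\
  (forall R : congruence S, malcev_nilpotent (quotient_sg R) ->
     forall x y : S, eta_star S x y -> R x y).
Proof.
split=> [|R nilR]; first exact/quotient_nilpotent/eta_sub_eta_star.
by apply: eta_star_min => x y; apply: eta_sub_nilpotent_congruence.
Qed.
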